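(* If $G$ is a graph with maximum degree at most $3$, girth at least $7$, and $\mathrm{mad}(G)<\frac{18}{7}$, then $\chi_l(G^2)\le 6$.
   Context: All graphs are finite and simple. $\mathrm{mad}(G)$, the maximum average degree of $G$, is the maximum of $2|E(H)|/|V(H)|$ over all induced subgraphs $H$ of $G$. The square $G^2$ of $G$ has vertex set $V(G)$, with two vertices adjacent if their distance in $G$ is at most $2$. $\chi_l$ denotes the list chromatic number. *)

(* Defs.v *)
From HB Require Import structures.
From mathcomp Require Import all_boot all_order all_algebra.
From mathcomp Require Import boolp.

Set Implicit Arguments.
Unset Strict Implicit.
Unset Printing Implicit Defensive.

Import Order.TTheory GRing.Theory Num.Theory.

Record sgraph := SGraph {
  vertex :> finType;
  adj : rel vertex;
  adj_sym : symmetric adj;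
  adj_irr : irreflexive adj }.

Definition edges (G : sgraph) : {set {set G}} :=
  [set A : {set G} | [exists x, exists y, adj x y && (A == [set x; y])]].

Definition degree (G : sgraph) (v : G) : nat := #|[set w | adj v w]|.

Definition max_degree (G : sgraph) : nat := \max_(v : G) degree v.

(* [ucycle] alone would also accept an edge traversed back and forth. *)
Definition is_graph_cycle (G : sgraph) (c : seq G) : Prop :=
  2 < size c /\ ucycle (@adj G) c.

(* The girth of a forest is infinite. *)
Definition girth_ge (G : sgraph) (g : nat) : Prop :=
  forall c : seq G, is_graph_cycle c -> g <= size c.

Section Induced.
Variables (G : sgraph) (S : {set G}).

Definition induced_adj : rel {x : G | x \in S} :=
  fun x y => adj (val x) (val y).

Lemma induced_sym : symmetric induced_adj.
Proof. by move=> x y; apply: adj_sym. Qed.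

Lemma induced_irr : irreflexive induced_adj.
Proof. by move=> x; apply: adj_irr. Qed.

Definition induced : sgraph := SGraph induced_sym induced_irr.
End Induced.

Definition average_degree (G : sgraph) : rat :=
  ((2 * #|edges G|)%:R / #|G|%:R)%R.

(* All average degrees are nonnegative, so the default value 0 only matters
   for the graph without vertices. *)
Definition mad (G : sgraph) : rat :=
  \big[Num.max/0%R]_(S : {set G} | S != set0) average_degree (induced S).

(* Distance at most k: there is a walk of length at most k. *)
Definition dist_le (G : sgraph) (k : nat) (x y : G) : bool :=
  [exists n : 'I_k.+1,
    [exists p : n.-tuple G, path (@adj G) x p && (last x p == y)]].

Lemma dist_le_sym (G : sgraph) (k : nat) : symmetric (@dist_le G k).
Proof.
suff H x y : @dist_le G k x y -> dist_le k y x.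
  by move=> x y; apply/idP/idP; apply: H.
case/existsP=> n /existsP[p /andP[xp /eqP <-]].
apply/existsP; exists n; apply/existsP.
have sz : size (rev (belast x p)) == n by rewrite size_rev size_belast size_tuple.
exists (Tuple sz) => /=; apply/andP; split.
  by rewrite rev_path; under eq_path do rewrite adj_sym.
by case: (tval p) => //= a s; rewrite rev_cons last_rcons.
Qed.

Section Square.
Variable G : sgraph.

Definition square_adj : rel G := fun x y => (x != y) && dist_le 2 x y.

Lemma square_sym : symmetric square_adj.
Proof. by move=> x y; rewrite /square_adj eq_sym dist_le_sym. Qed.

Lemma square_irr : irreflexive square_adj.
Proof. by move=> x; rewrite /square_adj eqxx. Qed.

Definition square : sgraph := SGraph square_sym square_irr.
End Square.

Definition proper_coloring (G : sgraph) (C : Type) (c : G -> C) : Prop :=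
  forall x y : G, adj x y -> c x <> c y.

Definition choosable (G : sgraph) (k : nat) : Prop :=
  forall (C : finType) (L : G -> {set C}), (forall v, k <= #|L v|) ->
    exists c : G -> C, proper_coloring c /\ (forall v, c v \in L v).

Lemma choosable_card (G : sgraph) : choosable G #|G|.
Proof.
move=> C L hL.
have L_n0 v : exists a, a \in L v.
  by apply/set0Pn; rewrite -card_gt0 (leq_trans _ (hL v)) //; apply/card_gt0P; exists v.
suff [c [cL cI]] : exists c : G -> C,
    (forall v, c v \in L v) /\ {in enum G &, injective c}.
  exists c; split=> // x y xy cxy.
  by move: xy; rewrite (cI x y) ?mem_enum // adj_irr.
elim: (enum G) (enum_uniq G) => [_|v s IH /= /andP[vs us]].
  by exists (fun v => xchoose (L_n0 v)); split=> // v; apply: xchooseP.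
have [c [cL cI]] := IH us.
have [a aL aN] : exists2 a, a \in L v & a \notin map c s.
  apply/exists_inP; rewrite -[X in is_true X]negbK negb_exists_in.
  apply/negP => /forall_inP sub.
  have : #|L v| <= #|map c s|.
    by apply/subset_leq_card/subsetP => a /sub; rewrite negbK.
  rewrite leqNgt => /negP; apply; apply: leq_ltn_trans (card_size _) _.
  rewrite size_map; apply: leq_trans (hL v).
  have <- : #|v :: s| = (size s).+1 by apply/card_uniqP; rewrite /= vs.
  exact: max_card.
exists (fun w => if w == v then a else c w); split=> [w|x y].
  by case: eqP => [->|].
rewrite !inE; case: (x =P v) => [-> _|_ /= xs]; case: (y =P v) => [-> //|_ /= ys].
- by move=> ac; rewrite ac map_f in aN.
- by move=> _ ca; rewrite -ca map_f in aN.
- exact: cI.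
Qed.

Lemma choosable_ex (G : sgraph) : exists k, `[< choosable G k >].
Proof. by exists #|G|; apply/asboolP/choosable_card. Qed.

Definition list_chromatic_number (G : sgraph) : nat := ex_minn (choosable_ex G).

(* Main.v *)
(* Induction on the number of non-isolated vertices.  If S is a set of vertices
   each of which has at most one neighbour outside S, a colouring of the square of
   G - S is legal in G^2 outside S, and a vertex s of S keeps at least
   6 + |N^2(s) :&: S| - \sum_(u in N(s)) deg u colours.  A list-colouring
   argument on S then excludes: vertices of degree at most 1; two adjacent
   2-vertices; a 3-vertex with three 2-neighbours a, b, d such that a has a
   neighbour with a further 2-neighbour; an 8-cycle alternating between 2- and
   3-vertices; and a path on seven vertices alternating between 2- and
   3-vertices, with 2-vertices at both ends that have no common neighbour.
   Regard the 2-vertices as edges between 3-vertices.  A component of the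
   resulting multigraph that avoids these configurations has at most 3/4 as many
   edges as vertices, which a local discharging turns into an average degree of
   at least 18/7. *)
Require Import Defs.
From mathcomp Require Import all_boot all_order all_algebra.
From mathcomp Require Import boolp zify.

Set Implicit Arguments.
Unset Strict Implicit.
Unset Printing Implicit Defensive.

Import Order.TTheory GRing.Theory Num.Theory.

(** * List colourings of small configurations *)

Section Picking.
Variable C : finType.
Implicit Types (A B D V X Y : {set C}) (r : seq C).

Lemma pick_notin_seq A r : size r < #|A| -> exists2 k, k \in A & k \notin r.
Proof.
move=> h; apply/exists_inP; rewrite -[X in is_true X]negbK negb_exists_in.
apply/negP => /forall_inP sub.
have : #|A| <= #|r| by apply/subset_leq_card/subsetP => a /sub; rewrite negbK.
by rewrite leqNgt (leq_ltn_trans (card_size r) h).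
Qed.

Lemma pick_notin A B : #|B| < #|A| -> exists2 k, k \in A & k \notin B.
Proof.
move=> h; have [|k kA] := @pick_notin_seq A (enum B); first by rewrite -cardE.
by rewrite mem_enum; exists k.
Qed.

(** If one of the first three lists is not contained in the next one, a colour of the difference is
    used first and the cycle is coloured the other way round; the vertex reached last then has to
    avoid only one colour. Otherwise the lists increase from [A1] to [A4], and two colours of [A1]
    alternate. *)
Lemma cycle4_coloring A1 A2 A3 A4 :
  1 < #|A1| -> 1 < #|A2| -> 1 < #|A3| -> 1 < #|A4| ->
  exists k1 k2 k3 k4,
    [/\ [/\ k1 \in A1, k2 \in A2, k3 \in A3 & k4 \in A4],
        k1 != k2, k2 != k3, k3 != k4 & k1 != k4].
Proof.
have P B1 B2 B3 B4 : 1 < #|B2| -> 1 < #|B3| -> 1 < #|B4| ->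
    ~~ (B1 \subset B2) -> exists k1 k2 k3 k4,
    [/\ [/\ k1 \in B1, k2 \in B2, k3 \in B3 & k4 \in B4],
        k1 != k2, k2 != k3, k3 != k4 & k1 != k4].
  move=> h2 h3 h4 /subsetPn[k1 k1A k1N].
  have [//|k4 k4A] := @pick_notin_seq B4 [:: k1]; rewrite !inE => n41.
  have [//|k3 k3A] := @pick_notin_seq B3 [:: k4]; rewrite !inE => n34.
  have [//|k2 k2A] := @pick_notin_seq B2 [:: k3]; rewrite !inE => n23.
  exists k1, k2, k3, k4; split=> //; last by rewrite eq_sym.
  by apply: contraNneq k1N => ->.
move=> h1 h2 h3 h4.
have [s12|/P] := boolP (A1 \subset A2); last exact.
have [s23|/P] := boolP (A2 \subset A3); last first.
  case/(_ A4 A1 h3 h4 h1) => k2 [k3 [k4 [k1 [[? ? ? ?] ? ? ? ?]]]].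
  by exists k1, k2, k3, k4; split; rewrite // eq_sym.
have [s34|/P] := boolP (A3 \subset A4); last first.
  case/(_ A1 A2 h4 h1 h2) => k3 [k4 [k1 [k2 [[? ? ? ?] ? ? ? ?]]]].
  by exists k1, k2, k3, k4; split; rewrite // eq_sym.
have [|a aA _] := @pick_notin_seq A1 [::]; first exact: ltnW.
have [//|b bA] := @pick_notin_seq A1 [:: a]; rewrite !inE => ba.
exists a, b, a, b; rewrite aA (subsetP s12) // (subsetP s23) ?(subsetP s12) //.
by rewrite (subsetP s34) ?(subsetP s23) ?(subsetP s12) // ba eq_sym ba.
Qed.

(** The fourth vertex is coloured so that the third keeps two candidates, one of which survives
    whatever the fifth vertex takes. The cases: [A2] has a colour outside [A1], which is given to
    the second vertex; [A1] has three colours, so the first vertex can come last; or [A1] and [A2]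
    are the same pair, and the candidates are taken outside it. *)
Lemma path4_two_extensions A1 A2 A3 A4 :
  1 < #|A1| -> 1 < #|A2| -> 3 < #|A3| -> 2 < #|A4| ->
  exists x y y', [/\ x \in A4, y != y' &
    forall z, z \in [:: y; y'] -> [/\ z \in A3, z != x &
      exists k1 k2, [/\ k1 \in A1, k2 \in A2, k1 != k2, k1 != z &
        (k2 != z) && (k2 != x)]]].
Proof.
move=> h1 h2 h3 h4.
have [s21|/subsetPn[k2 k2A k2N]] := boolP (A2 \subset A1); last first.
  have [|x xA] := @pick_notin_seq A4 [:: k2]; first exact: ltnW.
  rewrite !inE => x2.
  have [|y yA] := @pick_notin_seq A3 [:: x; k2]; first exact: ltnW.
  have [//|y' y'A] := @pick_notin_seq A3 [:: y; x; k2].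
  rewrite !inE !negb_or => /and3P[y'y y'x y'2] /andP[yx y2].
  exists x, y, y'; split; rewrite 1?eq_sym // => z.
  rewrite !inE => /orP zE.
  have [zA zx z2] : [/\ z \in A3, z != x & z != k2] by case: zE => /eqP ->.
  split=> //; have [//|k1 k1A] := @pick_notin_seq A1 [:: z]; rewrite !inE => k1z.
  exists k1, k2; split; rewrite // 1?[k2 == _]eq_sym ?z2 1?eq_sym //.
  by apply: contraNneq k2N => ->.
have [h1'|h1'] := leqP #|A1| 2; last first.
  have [|x xA _] := @pick_notin_seq A4 [::]; first exact: ltnW (ltnW _).
  have [//|k2 k2A] := @pick_notin_seq A2 [:: x]; rewrite !inE => k2x.
  have [|y yA] := @pick_notin_seq A3 [:: x; k2]; first exact: ltnW.
  have [//|y' y'A] := @pick_notin_seq A3 [:: y; x; k2].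
  rewrite !inE !negb_or => /and3P[y'y y'x y'2] /andP[yx y2].
  exists x, y, y'; split; rewrite 1?eq_sym // => z.
  rewrite !inE => /orP zE.
  have [zA zx z2] : [/\ z \in A3, z != x & z != k2] by case: zE => /eqP ->.
  split=> //; have [//|k1 k1A] := @pick_notin_seq A1 [:: z; k2].
  rewrite !inE negb_or => /andP[k1z k12].
  by exists k1, k2; split; rewrite // k2x andbT eq_sym.
have hD : 1 < #|A3 :\: A1|.
  rewrite cardsD; have := subset_leq_card (subsetIr A3 A1); lia.
have [|y yA _] := @pick_notin_seq (A3 :\: A1) [::]; first exact: ltnW.
have [//|y' y'A] := @pick_notin_seq (A3 :\: A1) [:: y]; rewrite !inE => y'y.
have [//|x xA] := @pick_notin_seq A4 [:: y; y'].
rewrite !inE negb_or => /andP[xy xy'].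
have [//|k2 k2A] := @pick_notin_seq A2 [:: x]; rewrite !inE => k2x.
have [//|k1 k1A] := @pick_notin_seq A1 [:: k2]; rewrite !inE => k12.
exists x, y, y'; split; rewrite 1?eq_sym // => z.
rewrite !inE => /orP zE.
have [zA zx] : z \in A3 :\: A1 /\ z != x by case: zE => /eqP ->; rewrite eq_sym.
move: zA; rewrite inE => /andP[zN zA].
split=> //; exists k1, k2; split=> //; first by apply: contraNneq zN => <-.
by rewrite k2x andbT; apply: contraNneq zN => <-; apply: (subsetP s21).
Qed.

Definition square_path7_coloring A1 A2 A3 A4 A5 A6 A7 k1 k2 k3 k4 k5 k6 k7 :=
  [/\ [/\ k1 \in A1, k2 \in A2, k3 \in A3 & k4 \in A4],
      [/\ k5 \in A5, k6 \in A6 & k7 \in A7],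
      [/\ k1 != k2, k2 != k3, k3 != k4 & k4 != k5],
      [/\ k5 != k6, k6 != k7, k1 != k3 & k2 != k4] &
      [/\ k3 != k5, k4 != k6 & k5 != k7]].

(** After the fourth vertex, the right side is coloured greedily in the order 6, 7, 5. One of the
    two candidates for the third vertex then differs from [k5], and it extends to the left. *)
Lemma square_path7 A1 A2 A3 A4 A5 A6 A7 :
  1 < #|A1| -> 1 < #|A2| -> 3 < #|A3| -> 2 < #|A4| ->
  3 < #|A5| -> 1 < #|A6| -> 1 < #|A7| ->
  exists k1 k2 k3 k4 k5 k6 k7,
    square_path7_coloring A1 A2 A3 A4 A5 A6 A7 k1 k2 k3 k4 k5 k6 k7.
Proof.
move=> h1 h2 h3 h4 h5 h6 h7.
have [k4 [y [y' [k4A yy' H]]]] := path4_two_extensions h1 h2 h3 h4.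
have [//|k6 k6A] := @pick_notin_seq A6 [:: k4]; rewrite !inE => n64.
have [//|k7 k7A] := @pick_notin_seq A7 [:: k6]; rewrite !inE => n76.
have [//|k5 k5A] := @pick_notin_seq A5 [:: k4; k6; k7].
rewrite !inE !negb_or => /and3P[n54 n56 n57].
have [k3 k3y n35] : exists2 k3, k3 \in [:: y; y'] & k3 != k5.
  have [E|yk] := eqVneq y k5; last by exists y; rewrite ?inE ?eqxx.
  by exists y'; rewrite ?inE ?eqxx ?orbT // -E eq_sym.
have [k3A n34 [k1 [k2 [k1A k2A n12 n13 /andP[n23 n24]]]]] := H _ k3y.
by exists k1, k2, k3, k4, k5, k6, k7; split; split; rewrite // eq_sym.
Qed.

(* For the paths p1 ... p7 whose end p1 has its outer neighbour adjacent to p6: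
   a 7-cycle, which the girth condition allows. *)
Lemma square_path7_chord16 A1 A2 A3 A4 A5 A6 A7 :
  2 < #|A1| -> 1 < #|A2| -> 3 < #|A3| -> 2 < #|A4| ->
  3 < #|A5| -> 2 < #|A6| -> 1 < #|A7| ->
  exists k1 k2 k3 k4 k5 k6 k7,
    square_path7_coloring A1 A2 A3 A4 A5 A6 A7 k1 k2 k3 k4 k5 k6 k7 /\ k1 != k6.
Proof.
move=> h1 h2 h3 h4 h5 h6 h7.
(* [k6] leaves two colours for the seventh vertex, which comes last and then has to avoid only
   [k5]. *)
have [k6 [k6A H7]] : exists k6, k6 \in A6 /\ 1 < #|A7 :\ k6|.
  have [h7'|h7'] := leqP #|A7| 2.
    have [|k kA kN] := @pick_notin A6 A7; first exact: leq_ltn_trans h7' h6.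
    by exists k; split=> //; rewrite (cardsD1 k) (negPf kN) in h7.
  have [|k kA _] := @pick_notin_seq A6 [::]; first by rewrite /=; lia.
  by exists k; split=> //; move: h7'; rewrite (cardsD1 k); lia.
have [|k4 k4A] := @pick_notin_seq A4 [:: k6]; first exact: ltnW.
rewrite !inE => n46.
have [//|k2 k2A] := @pick_notin_seq A2 [:: k4]; rewrite !inE => n24.
have [//|k1 k1A] := @pick_notin_seq A1 [:: k2; k6].
rewrite !inE negb_or => /andP[n12 n16].
have [//|k3 k3A] := @pick_notin_seq A3 [:: k4; k2; k1].
rewrite !inE !negb_or => /and3P[n34 n32 n31].
have [//|k5 k5A] := @pick_notin_seq A5 [:: k4; k6; k3].
rewrite !inE !negb_or => /and3P[n54 n56 n53].
have [//|k7] := @pick_notin_seq (A7 :\ k6) [:: k5].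
rewrite !inE => /andP[n76 k7A] n75.
by exists k1, k2, k3, k4, k5, k6, k7; split=> //; split; split; rewrite // eq_sym.
Qed.

(** In the square of an 8-cycle each parity class spans a 4-cycle. The [A] class is coloured
    greedily; every list of the other class loses at most two colours, and [cycle4_coloring]
    finishes. *)
Lemma square_cycle8 A1 B1 A2 B2 A3 B3 A4 B4 :
  2 < #|A1| -> 3 < #|B1| -> 2 < #|A2| -> 3 < #|B2| ->
  2 < #|A3| -> 3 < #|B3| -> 2 < #|A4| -> 3 < #|B4| ->
  exists a1 b1 a2 b2 a3 b3 a4 b4,
    [/\ [/\ a1 \in A1, a2 \in A2, a3 \in A3 & a4 \in A4],
        [/\ b1 \in B1, b2 \in B2, b3 \in B3 & b4 \in B4],
        [/\ a1 != a2, a2 != a3, a3 != a4 & a1 != a4],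
        [/\ b1 != b2, b2 != b3, b3 != b4 & b1 != b4] &
        [/\ (a1 != b1) && (b1 != a2), (a2 != b2) && (b2 != a3),
            (a3 != b3) && (b3 != a4) & (a4 != b4) && (a1 != b4)]].
Proof.
move=> hA1 hB1 hA2 hB2 hA3 hB3 hA4 hB4.
have [|a1 a1A _] := @pick_notin_seq A1 [::]; first by rewrite /=; lia.
have [|a2 a2A] := @pick_notin_seq A2 [:: a1]; first by rewrite /=; lia.
rewrite !inE => n21.
have [|a3 a3A] := @pick_notin_seq A3 [:: a2]; first by rewrite /=; lia.
rewrite !inE => n32.
have [//|a4 a4A] := @pick_notin_seq A4 [:: a3; a1].
rewrite !inE negb_or => /andP[n43 n41].
have two (B : {set C}) x y : 3 < #|B| -> 1 < #|B :\ x :\ y|.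
  by rewrite (cardsD1 x) (cardsD1 y (B :\ x)); lia.
have [b1 [b2 [b3 [b4 [[]]]]]] := cycle4_coloring
  (two _ a1 a2 hB1) (two _ a2 a3 hB2) (two _ a3 a4 hB3) (two _ a4 a1 hB4).
rewrite !inE => /and3P[? ? ?] /and3P[? ? ?] /and3P[? ? ?] /and3P[? ? ?] ? ? ? ?.
exists a1, b1, a2, b2, a3, b3, a4, b4.
by split; split; rewrite // 1?eq_sym //; apply/andP; split; rewrite // eq_sym.
Qed.

(** Here [v] has the neighbours [a], [b], [d], and the path [v], [a] continues through [x] to [y].
    The colour of [v] is chosen so that [B] keeps three colours, by avoiding [B] when it has only
    three; the order [x], [y], [a], [d], [b] is then greedy. *)
Lemma fork_coloring V A B D X Y :
  3 < #|V| -> 4 < #|A| -> 2 < #|B| -> 2 < #|D| -> 1 < #|X| -> 1 < #|Y| ->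
  exists v a b d x y,
    [/\ [/\ v \in V, a \in A & b \in B], [/\ d \in D, x \in X & y \in Y],
        [/\ v != a, v != b, v != d & a != b],
        [/\ a != d, b != d, v != x & a != x] & (a != y) && (x != y)].
Proof.
move=> hV hA hB hD hX hY.
have [v [vV HB]] : exists v, v \in V /\ 2 < #|B :\ v|.
  have [hB'|hB'] := leqP #|B| 3.
    have [|k kA kN] := @pick_notin V B; first exact: leq_ltn_trans hB' hV.
    by exists k; split=> //; rewrite (cardsD1 k) (negPf kN) in hB.
  have [|k kA _] := @pick_notin_seq V [::]; first by rewrite /=; lia.
  by exists k; split=> //; move: hB'; rewrite (cardsD1 k); lia.
have [//|x xX] := @pick_notin_seq X [:: v]; rewrite !inE => nxv.
have [//|y yY] := @pick_notin_seq Y [:: x]; rewrite !inE => nyx.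
have [|a aA] := @pick_notin_seq A [:: x; y; v]; first exact: ltnW.
rewrite !inE !negb_or => /and3P[nax nay nav].
have [//|d dD] := @pick_notin_seq D [:: v; a].
rewrite !inE negb_or => /andP[ndv nda].
have [//|b] := @pick_notin_seq (B :\ v) [:: a; d].
rewrite !inE negb_or => /andP[nbv bB] /andP[nba nbd].
exists v, a, b, d, x, y; rewrite nay [x == y]eq_sym nyx.
by split; split; rewrite // 1?eq_sym.
Qed.
End Picking.

(** * Squares of graphs of girth at least 7 *)

Section SquareColoring.
Variable T : finType.
Implicit Types (e : rel T) (x y z : T) (S : seq T).

Definition nbr e x := [set y | e x y].

Definition sq e : rel T :=
  fun x y => (x != y) && (e x y || [exists z, e x z && e z y]).

(* Stands for vertex deletion, keeping the vertex type fixed. *)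
Definition isolate S e : rel T := fun x y => [&& e x y, x \notin S & y \notin S].

Definition square_coloring (C : finType) (L : T -> {set C}) e (c : T -> C) :=
  (forall x, c x \in L x) /\ (forall x y, sq e x y -> c x != c y).

Definition avail (C : finType) (L : T -> {set C}) e S (c : T -> C) x : {set C} :=
  L x :\: [set c y | y in [set y | sq e x y & y \notin S]].

Definition girth7 e := forall c, 2 < size c -> ucycle e c -> 7 <= size c.

Lemma sq_sym e : symmetric e -> symmetric (sq e).
Proof.
move=> es x y; rewrite /sq eq_sym es; congr (_ && (_ || _)).
by apply/existsP/existsP => -[z /andP[xz zy]]; exists z; rewrite es zy es.
Qed.

Lemma sq_path e x y z : e x z -> e z y -> x != y -> sq e x y.
Proof.
by move=> xz zy n; rewrite /sq n; apply/orP; right; apply/existsP; exists z; rewrite xz.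
Qed.

Lemma sq_edge e x y : e x y -> x != y -> sq e x y.
Proof. by move=> xy n; rewrite /sq n xy. Qed.

(** [c] is only known to be proper for the square after isolating the vertices of [zs]. Two outside
    vertices with a common neighbour among these are excluded by the bound of one outside neighbour,
    so [c] is proper outside; [avail] settles the mixed pairs and the [pairwise] condition the pairs
    inside. *)
Lemma extend_square_coloring e (C : finType) (L : T -> {set C}) (zs : seq (T * C))
    (c : T -> C) :
  symmetric e ->
  square_coloring L (isolate (unzip1 zs) e) c ->
  all (fun x => #|nbr e x :\: [set y in unzip1 zs]| <= 1) (unzip1 zs) ->
  all (fun a => a.2 \in avail L e (unzip1 zs) c a.1) zs ->
  pairwise (fun a b => sq e a.1 b.1 ==> (a.2 != b.2)) zs ->
  exists c', square_coloring L e c'.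
Proof.
move=> es [cL cP] /allP out /allP av pw.
set S := unzip1 zs in cP out av.
(* Outside [S] the index is past the end, so the default makes [c'] agree with [c]. *)
pose c' x := nth (c x) (unzip2 zs) (index x S).
have c'out x : x \notin S -> c' x = c x.
  move=> xS; rewrite /c' nth_default // size_map -(size_map fst zs).
  by move: xS; rewrite -index_mem -leqNgt.
have c'in x : x \in S -> (x, c' x) \in zs.
  move=> xS; have hi : index x S < size zs by rewrite -(size_map fst) index_mem.
  have -> : (x, c' x) = nth (x, c x) zs (index x S).
    rewrite [RHS]surjective_pairing /c' (nth_map (x, c x)) //.
    by rewrite -(nth_map _ x fst) // nth_index.
  exact: mem_nth.
exists c'; split=> [x|].
  have [xS|xS] := boolP (x \in S); last by rewrite c'out.
  by have := av _ (c'in x xS); rewrite /avail inE => /andP[].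
have half x y : x \in S -> y \notin S -> sq e x y -> c' x != c' y.
  move=> xS yS xy; rewrite (c'out y) //; have := av _ (c'in x xS).
  rewrite inE => /andP[h _]; apply: contraNneq h => /= ->.
  by apply/imsetP; exists y; rewrite // inE xy.
move=> x y xy; have yx : sq e y x by rewrite sq_sym.
have [xS|xS] := boolP (x \in S); have [yS|yS] := boolP (y \in S).
- have both u v : u \in S -> v \in S -> sq e u v -> index u S < index v S ->
      c' u != c' v.
    move=> uS vS uv uvS; have [n0 _] := andP uv.
    have hv : index v S < size zs by rewrite -(size_map fst) index_mem.
    have hu : index u S < size zs by apply: ltn_trans hv.
    have := (pairwiseP (u, c u) pw) (index u S) (index v S) hu hv uvS.
    rewrite -!(nth_map _ u fst) // !nth_index // uv /=.
    rewrite -!(nth_map (u, c u) (c u) snd) // /c'.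
    by rewrite (@set_nth_default _ _ (c u) (c v)) // size_map.
  have [lt|lt|] := ltngtP (index x S) (index y S).
  + exact: both.
  + by rewrite eq_sym; apply: both.
  + by move/(index_inj x xS yS) => E; move: xy; rewrite E /sq eqxx.
- exact: half.
- by rewrite eq_sym; apply: half.
- rewrite !c'out //; apply: cP; case/andP: xy => n /orP[xy|/existsP[z /andP[xz zy]]].
    by apply: sq_edge => //; rewrite /isolate xy xS.
  have zS : z \notin S.
    apply/negP => zS; have := out _ zS; rewrite leqNgt => /negP; apply.
    apply: leq_trans (_ : #|[set x; y]| <= _); first by rewrite cards2 n.
    by apply/subset_leq_card/subsetP => u; rewrite !inE => /orP[]/eqP ->;
      rewrite ?xS ?yS // es.
  by apply: (@sq_path _ _ _ z); rewrite // /isolate ?xz ?zy ?xS ?yS ?zS.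
Qed.

(** A neighbour [y] of [x] accounts for at most [deg y] square-neighbours of [x]: itself and its
    neighbours other than [x]. Those listed in [r] lie in [S] and forbid no colour. *)
Lemma avail_card e (C : finType) (L : T -> {set C}) S (c : T -> C) x (r : seq T) :
  symmetric e -> 6 <= #|L x| -> uniq r -> all (sq e x) r -> all [in S] r ->
  6 + size r <= #|avail L e S c x| + \sum_(y in nbr e x) #|nbr e y|.
Proof.
move=> es hL ur /allP rx /allP rS.
set N2 := [set y | sq e x y & y \notin S].
have h1 : #|L x| <= #|avail L e S c x| + #|N2|.
  rewrite /avail cardsD -/N2.
  have h : #|L x :&: [set c y | y in N2]| <= #|N2|.
    exact: leq_trans (subset_leq_card (subsetIr _ _)) (leq_imset_card _ _).
  have := subset_leq_card (subsetIl (L x) [set c y | y in N2]); lia.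
have h2 : #|N2| + size r <= #|[set y | sq e x y]|.
  rewrite -(card_uniqP ur) -cardsE -(cardsID [set y in S] [set y | sq e x y]) addnC.
  apply: leq_add; apply/subset_leq_card/subsetP => y; rewrite !inE.
    by move=> yr; rewrite rx //; apply: rS.
  by case/andP=> -> ->.
have h3 : #|[set y | sq e x y]| <= \sum_(y in nbr e x) #|nbr e y|.
  apply: (@leq_trans #|\bigcup_(y in nbr e x) (y |: (nbr e y :\ x))|).
    apply/subset_leq_card/subsetP => y; rewrite inE.
    case/andP=> n /orP[xy|/existsP[z /andP[xz zy]]]; apply/bigcupP.
      by exists y; rewrite !inE ?eqxx.
    by exists z; rewrite !inE // [y == x]eq_sym n zy orbT.
  apply: (@leq_trans (\sum_(y in nbr e x) #|y |: (nbr e y :\ x)|)).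
    elim/big_rec2: _ => [|y u A _ le]; first by rewrite cards0.
    by apply: leq_trans (leq_card_setU _ _) _; rewrite leq_add2l.
  apply: leq_sum => y; rewrite inE => xy.
  rewrite cardsU1 (cardsD1 x (nbr e y)) [x \in _]inE.
  by rewrite es xy; case: (y \notin _); lia.
lia.
Qed.

(** * Short walks in a graph of girth at least 7 *)

Section Girth.
Variable e : rel T.
Hypotheses (es : symmetric e) (ei : irreflexive e) (eg : girth7 e).

Fixpoint nonbacktracking (s : seq T) :=
  if s is x :: ((_ :: y :: _) as s') then (x != y) && nonbacktracking s' else true.

(** The tail is repetition-free by induction, so a return to the first vertex closes a cycle on at
    most six vertices. Irreflexivity and [nonbacktracking] exclude one and two vertices, the girth
    excludes the rest. *)
Lemma walk_uniq s : size s <= 7 -> sorted e s -> nonbacktracking s -> uniq s.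
Proof.
elim: s => // x s IH sz xs nb.
have us : uniq s.
  apply: IH; [exact: ltnW | exact: path_sorted xs | ].
  by move: nb; case: (s) => //= a [] //= b t /andP[].
rewrite cons_uniq us andbT; apply/negP => xin.
case/splitPr: xin IH sz xs nb us => s1 s2 _; rewrite cat_uniq /= size_cat /= => sz.
rewrite cat_path /= => /and3P[xs1 ls1 _] nb /and3P[us1 /norP[xs1N _] _].
have cyc : ucycle e (x :: s1).
  by apply/andP; rewrite /= rcons_path xs1 ls1 us1 xs1N.
case: s1 sz xs1 ls1 nb us1 xs1N cyc => [|a [|b s1]] sz xs1 ls1 nb us1 xs1N cyc.
- by rewrite /= ei in ls1.
- by rewrite /= eqxx in nb.
- by have /= := eg _ cyc; move: sz => /=; lia.
Qed.

Lemma no_closed_walk x s : 0 < size s <= 6 -> path e x s -> last x s = x ->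
  nonbacktracking (x :: s) -> False.
Proof.
case/andP=> s0 s6 xs ls nb; have := walk_uniq (s := x :: s) s6 xs nb.
by case: s s0 {s6 xs nb} ls => // a s _ /= ls; rewrite -{1}ls mem_last.
Qed.

Lemma edge_neq x y : e x y -> x != y.
Proof. by apply: contraTneq => ->; rewrite ei. Qed.

(** A connection of length at most two between the ends would close the walk to one of length at
    most five. If the connection runs through [b], that closed walk backtracks, and the triangle
    [x], [a], [b] is used instead. *)
Lemma far3 x a b y : e x a -> e a b -> e b y -> x != b -> a != y -> ~~ sq e x y.
Proof.
move=> xa ab By nxb nay; have nax : a != x by rewrite eq_sym edge_neq.
apply/negP => /andP[nxy /orP[xy|/existsP[z /andP[xz zy]]]].
  apply: (@no_closed_walk x [:: a; b; y; x]) => //=.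
    by rewrite xa ab By es xy.
  by rewrite nxb nay eq_sym nxb.
have [zb|nzb] := eqVneq z b.
  apply: (@no_closed_walk x [:: a; b; x]) => //=; last by rewrite nxb nax.
  by rewrite xa ab es -zb xz.
apply: (@no_closed_walk x [:: a; b; y; z; x]) => //=.
  by rewrite xa ab By es zy es xz.
by rewrite nxb nay (eq_sym b) nzb eq_sym nxy.
Qed.

(** The closed walks now have length at most six. Four edges are the limit of this argument: the
    ends of a walk with five edges can have a common neighbour on a 7-cycle, whence
    [square_path7_chord16]. *)
Lemma far4 x a b c y : e x a -> e a b -> e b c -> e c y ->
  x != b -> a != c -> b != y -> ~~ sq e x y.
Proof.
move=> xa ab bc cy nxb nac nby.
have ncx : c != x.
  apply/negP => /eqP cx; apply: (@no_closed_walk x [:: a; b; x]) => //=.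
    by rewrite xa ab -cx bc.
  by rewrite nxb eq_sym edge_neq.
apply/negP => /andP[nxy /orP[xy|/existsP[z /andP[xz zy]]]].
  apply: (@no_closed_walk x [:: a; b; c; y; x]) => //=.
    by rewrite xa ab bc cy es xy.
  by rewrite nxb nac nby ncx.
have [zc|nzc] := eqVneq z c.
  apply: (@no_closed_walk x [:: a; b; c; x]) => //=.
    by rewrite xa ab bc es -zc xz.
  by rewrite nxb nac eq_sym nxb.
apply: (@no_closed_walk x [:: a; b; c; y; z; x]) => //=.
  by rewrite xa ab bc cy es zy es xz.
by rewrite nxb nac nby (eq_sym c) nzc eq_sym nxy.
Qed.
End Girth.

Lemma outside_le1 e x (r S : seq T) :
  uniq r -> all (e x) r -> all [in S] r -> #|nbr e x| <= (size r).+1 ->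
  #|nbr e x :\: [set y in S]| <= 1.
Proof.
move=> ur /allP xr /allP rS le.
have : size r <= #|nbr e x :&: [set y in S]|.
  rewrite -(card_uniqP ur); apply/subset_leq_card/subsetP => y yr.
  by rewrite !inE xr //; apply: rS.
have := cardsID [set y in S] (nbr e x); lia.
Qed.

(** Each listed neighbour, having degree at most 2, saves one against the bound of three per
    neighbour. *)
Lemma sum_degree_nbr e x (r : seq T) :
  (forall y, #|nbr e y| <= 3) -> uniq r -> all (e x) r ->
  all (fun y => #|nbr e y| <= 2) r ->
  \sum_(y in nbr e x) #|nbr e y| + size r <= 3 * #|nbr e x|.
Proof.
move=> d3 ur /allP xr /allP r2.
have [R memR <-] : exists2 R : {set T}, R =i r & #|R| = size r.
  by exists [set y in r]; [move=> y; rewrite inE | rewrite cardsE (card_uniqP ur)].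
have RN : R \subset nbr e x by apply/subsetP => y; rewrite memR inE => /xr.
rewrite (big_setID R) /= (setIidPr RN).
have h1 : \sum_(y in R) #|nbr e y| <= \sum_(y in R) 2.
  by apply: leq_sum => y; rewrite memR => /r2.
have h2 : \sum_(y in nbr e x :\: R) #|nbr e y| <= \sum_(y in nbr e x :\: R) 3.
  by apply: leq_sum.
move: h1 h2; rewrite !sum_nat_const cardsD (setIidPr RN).
have := subset_leq_card RN; lia.
Qed.
End SquareColoring.

(** * Reducible configurations *)

Section Reducible.
Variables (T : finType) (e : rel T) (C : finType) (L : T -> {set C}).
Hypotheses (es : symmetric e) (ei : irreflexive e) (eg : girth7 e).
Hypothesis d3 : forall x, #|nbr e x| <= 3.
Hypothesis L6 : forall x, 6 <= #|L x|.

Definition reducible S :=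
  (exists c, square_coloring L (isolate S e) c) -> exists c, square_coloring L e c.

(** Combining both counts leaves at least 6 + |r| + |t| - 3m colours, where [r] lists
    square-neighbours in [S] and [t] lists neighbours of degree at most 2. Every numerical bound for
    the configurations below comes from such a choice of [r] and [t]. *)
Lemma avail_gt n m S (c : T -> C) x (r t : seq T) :
  uniq r -> all (sq e x) r -> all [in S] r ->
  uniq t -> all (e x) t -> all (fun y => #|nbr e y| <= 2) t ->
  #|nbr e x| <= m -> n + 3 * m < 6 + size r + size t -> n < #|avail L e S c x|.
Proof.
move=> ur xr rS ut xt t2 xm.
have := avail_card c es (L6 x) ur xr rS; have := sum_degree_nbr d3 ut xt t2; lia.
Qed.

Ltac split_andb := repeat match goal with
  | H : is_true (_ && _) |- _ => case/andP: H => ? ? end.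
(* [repeat (apply/andP; split)] would also unfold [sq]. *)
Ltac split_goal := repeat match goal with
  | |- is_true (_ && _) => apply/andP; split end.
Ltac split_uniq := rewrite /= ?inE ?negb_or => ?; split_andb.
Ltac mirror := repeat match goal with
  | H : is_true (e ?x ?y) |- _ => lazymatch goal with
      | K : is_true (e y x) |- _ => fail
      | _ => have : is_true (e y x) by [rewrite es]; move=> ? end end.
Ltac neq := first [ assumption | rewrite eq_sym; assumption ].
Ltac near := idtac; match goal with
  | |- is_true (sq e _ _) => assumption
  | H : is_true (e ?x ?y) |- is_true (sq e ?x ?y) => apply: (sq_edge H); neq
  | H : is_true (e ?x ?z), K : is_true (e ?z ?y) |- is_true (sq e ?x ?y) =>
      apply: (sq_path H K); neq
  end.
Ltac conj_by t := rewrite /= ?andbT; split_goal; first [done | t].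
Ltac member := try match goal with S := _ |- _ => subst S end; by rewrite /= ?inE ?eqxx ?orbT.
Ltac distinct := rewrite /= ?inE ?negb_or /= ?andbT; split_goal; first [done | neq].
Ltac apart := idtac; match goal with
  | F : is_true (~~ sq e ?x ?y) |- is_true (sq e ?x ?y ==> _) =>
      by rewrite (negPf F)
  | F : is_true (~~ sq e ?y ?x) |- is_true (sq e ?x ?y ==> _) =>
      by rewrite (sq_sym es x y) (negPf F)
  | _ => apply/implyP => _; neq
  end.
Ltac count_avail r t :=
  apply: (@avail_gt _ _ _ _ _ r t);
    [distinct | conj_by near | member | distinct | conj_by assumption
    | conj_by assumption | eassumption | done].
Ltac few_outside r :=
  apply: (@outside_le1 _ _ _ r); [distinct | conj_by assumption | member | assumption].

Lemma reducible_degree1 x : #|nbr e x| <= 1 -> reducible [:: x].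
Proof.
move=> x1 [c cP].
have : 0 < #|avail L e [:: x] c x|.
  by count_avail ([::] : seq T) ([::] : seq T).
case/card_gt0P => k kA.
apply: (@extend_square_coloring T e C L [:: (x, k)] c es cP) => //=; last by rewrite kA.
by rewrite andbT; few_outside ([::] : seq T).
Qed.

Lemma reducible_adjacent_degree2 x y :
  e x y -> #|nbr e x| <= 2 -> #|nbr e y| <= 2 -> reducible [:: x; y].
Proof.
move=> xy x2 y2 [c cP]; have nxy := edge_neq ei xy; mirror.
have hx : 0 < #|avail L e [:: x; y] c x| by count_avail [:: y] [:: y].
have hy : 1 < #|avail L e [:: x; y] c y| by count_avail [:: x] [:: x].
have [k kA _] := pick_notin_seq (r := [::]) hx.
have [k' kA' ] := pick_notin_seq (r := [:: k]) hy; rewrite inE => n.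
apply: (@extend_square_coloring T e C L [:: (x, k); (y, k')] c es cP).
- by rewrite /= andbT; apply/andP; split; [few_outside [:: y] | few_outside [:: x]].
- by rewrite /= kA kA'.
- by conj_by apart.
Qed.

(** Of the 15 pairs among the six vertices, ten are the constraints of [fork_coloring]; the other
    five are ends of nonbacktracking walks with three or four edges, hence not adjacent in the
    square. *)
Lemma reducible_fork v a b d x y :
  e v a -> e v b -> e v d -> e a x -> e x y ->
  #|nbr e a| <= 2 -> #|nbr e b| <= 2 -> #|nbr e d| <= 2 -> #|nbr e y| <= 2 ->
  a != b -> a != d -> b != d -> v != x -> a != y ->
  reducible [:: v; a; b; d; x; y].
Proof.
move=> va vb vd ax xy a2 b2 d2 y2 nab nad nbd nvx nay [c cP].
set S := [:: v; a; b; d; x; y] in cP *.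
mirror.
have : uniq [:: b; v; a; x; y].
  by apply: (walk_uniq ei eg); [ | conj_by assumption | distinct].
split_uniq.
have : uniq [:: d; v; a; x; y].
  by apply: (walk_uniq ei eg); [ | conj_by assumption | distinct].
split_uniq.
have Fyv : ~~ sq e y v by apply: (@far3 _ _ es ei eg y x a v) => //; neq.
have Fxb : ~~ sq e x b by apply: (@far3 _ _ es ei eg x a v b) => //; neq.
have Fxd : ~~ sq e x d by apply: (@far3 _ _ es ei eg x a v d) => //; neq.
have Fyb : ~~ sq e y b by apply: (@far4 _ _ es ei eg y x a v b) => //; neq.
have Fyd : ~~ sq e y d by apply: (@far4 _ _ es ei eg y x a v d) => //; neq.
have dv := d3 v; have dx := d3 x.
have hv : 3 < #|avail L e S c v| by count_avail [:: a; b; d; x] [:: a; b; d].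
have ha : 4 < #|avail L e S c a| by count_avail [:: v; b; d; x; y] ([::] : seq T).
have hb : 2 < #|avail L e S c b| by count_avail [:: v; a; d] ([::] : seq T).
have hd : 2 < #|avail L e S c d| by count_avail [:: v; a; b] ([::] : seq T).
have hx : 1 < #|avail L e S c x| by count_avail [:: v; a; y] [:: a; y].
have hy : 1 < #|avail L e S c y| by count_avail [:: a; x] ([::] : seq T).
have [kv [ka [kb [kd [kx [ky [[? ? ?] [? ? ?] [? ? ? ?] [? ? ? ?] ?]]]]]]] :=
  fork_coloring hv ha hb hd hx hy.
split_andb.
apply: (@extend_square_coloring T e C L
  [:: (v, kv); (a, ka); (b, kb); (d, kd); (x, kx); (y, ky)] c es cP).
- rewrite /= andbT; split_goal.
  + few_outside [:: a; b].
  + few_outside [:: v].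
  + few_outside [:: v].
  + few_outside [:: v].
  + few_outside [:: a; y].
  + few_outside [:: x].
- by conj_by assumption.
- by conj_by apart.
Qed.

Lemma reducible_cycle8 v1 s1 v2 s2 v3 s3 v4 s4 :
  path e v1 [:: s1; v2; s2; v3; s3; v4; s4; v1] ->
  all (fun s => #|nbr e s| <= 2) [:: s1; s2; s3; s4] ->
  cycle (fun x y => x != y) [:: v1; v2; v3; v4] ->
  cycle (fun x y => x != y) [:: s1; s2; s3; s4] ->
  reducible [:: v1; s1; v2; s2; v3; s3; v4; s4].
Proof.
rewrite /= !andbT => ? ? ? ? [c cP]; split_andb; mirror.
set S := [:: v1; s1; v2; s2; v3; s3; v4; s4] in cP *.
(* Eight vertices are too many for [walk_uniq]. Two overlapping walks on seven vertices separate all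
   pairs except [v1] and [s4], which are adjacent. *)
have : uniq [:: v1; s1; v2; s2; v3; s3; v4].
  by apply: (walk_uniq ei eg); [ | conj_by assumption | distinct].
split_uniq.
have : uniq [:: s1; v2; s2; v3; s3; v4; s4].
  by apply: (walk_uniq ei eg); [ | conj_by assumption | distinct].
split_uniq.
have n14 : v1 != s4 by apply: (edge_neq ei).
have F3_0 : ~~ sq e v1 s2 by apply: (@far3 _ _ es ei eg _ s1 v2) => //; neq.
have F4_0 : ~~ sq e v1 v3 by apply: (@far4 _ _ es ei eg _ s1 v2 s2) => //; neq.
have F3_1 : ~~ sq e s1 v3 by apply: (@far3 _ _ es ei eg _ v2 s2) => //; neq.
have F4_1 : ~~ sq e s1 s3 by apply: (@far4 _ _ es ei eg _ v2 s2 v3) => //; neq.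
have F3_2 : ~~ sq e v2 s3 by apply: (@far3 _ _ es ei eg _ s2 v3) => //; neq.
have F4_2 : ~~ sq e v2 v4 by apply: (@far4 _ _ es ei eg _ s2 v3 s3) => //; neq.
have F3_3 : ~~ sq e s2 v4 by apply: (@far3 _ _ es ei eg _ v3 s3) => //; neq.
have F4_3 : ~~ sq e s2 s4 by apply: (@far4 _ _ es ei eg _ v3 s3 v4) => //; neq.
have F3_4 : ~~ sq e v3 s4 by apply: (@far3 _ _ es ei eg _ s3 v4) => //; neq.
have F3_5 : ~~ sq e s3 v1 by apply: (@far3 _ _ es ei eg _ v4 s4) => //; neq.
have F3_6 : ~~ sq e v4 s1 by apply: (@far3 _ _ es ei eg _ s4 v1) => //; neq.
have F3_7 : ~~ sq e s4 v2 by apply: (@far3 _ _ es ei eg _ v1 s1) => //; neq.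
have deg1 := d3 v1.
have deg2 := d3 v2.
have deg3 := d3 v3.
have deg4 := d3 v4.
have hv1 : 2 < #|avail L e S c v1| by count_avail [:: v4; s4; s1; v2] [:: s4; s1].
have hs1 : 3 < #|avail L e S c s1| by count_avail [:: s4; v1; v2; s2] ([::] : seq T).
have hv2 : 2 < #|avail L e S c v2| by count_avail [:: v1; s1; s2; v3] [:: s1; s2].
have hs2 : 3 < #|avail L e S c s2| by count_avail [:: s1; v2; v3; s3] ([::] : seq T).
have hv3 : 2 < #|avail L e S c v3| by count_avail [:: v2; s2; s3; v4] [:: s2; s3].
have hs3 : 3 < #|avail L e S c s3| by count_avail [:: s2; v3; v4; s4] ([::] : seq T).
have hv4 : 2 < #|avail L e S c v4| by count_avail [:: v3; s3; s4; v1] [:: s3; s4].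
have hs4 : 3 < #|avail L e S c s4| by count_avail [:: s3; v4; v1; s1] ([::] : seq T).
have [a1 [b1 [a2 [b2 [a3 [b3 [a4 [b4 [[? ? ? ?] [? ? ? ?] [? ? ? ?] [? ? ? ?] [? ? ? ?]]]]]]]]]] :=
  square_cycle8 hv1 hs1 hv2 hs2 hv3 hs3 hv4 hs4.
split_andb.
apply: (@extend_square_coloring T e C L [:: (v1, a1); (s1, b1); (v2, a2); (s2, b2);
  (v3, a3); (s3, b3); (v4, a4); (s4, b4)] c es cP).
- rewrite /= andbT; split_goal.
  + few_outside [:: s4; s1].
  + few_outside [:: v1].
  + few_outside [:: s1; s2].
  + few_outside [:: v2].
  + few_outside [:: s2; s3].
  + few_outside [:: v3].
  + few_outside [:: s3; s4].
  + few_outside [:: v4].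
- by conj_by assumption.
- by conj_by apart.
Qed.

(** Pairs three or four steps apart are not adjacent in the square. Of the pairs five steps apart,
    [p1], [p6] and [p2], [p7], at most one is; its ends then each have one more uncoloured
    square-neighbour and so gain the colour that [square_path7_chord16] asks for. *)
Lemma reducible_path7 p1 p2 p3 p4 p5 p6 p7 :
  path e p1 [:: p2; p3; p4; p5; p6; p7] ->
  all (fun s => #|nbr e s| <= 2) [:: p1; p3; p5; p7] ->
  [&& p1 != p3, p2 != p4, p3 != p5, p4 != p6 & p5 != p7] ->
  ~~ sq e p1 p7 -> ~~ (sq e p1 p6 && sq e p2 p7) ->
  reducible [:: p1; p2; p3; p4; p5; p6; p7].
Proof.
rewrite /= !andbT => ? ? ? F17 F1627 [c cP]; split_andb; mirror.
set S := [:: p1; p2; p3; p4; p5; p6; p7] in cP *.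
have : uniq [:: p1; p2; p3; p4; p5; p6; p7].
  by apply: (walk_uniq ei eg); [ | conj_by assumption | distinct].
split_uniq.
have F14 : ~~ sq e p1 p4 by apply: (@far3 _ _ es ei eg _ p2 p3) => //; neq.
have F25 : ~~ sq e p2 p5 by apply: (@far3 _ _ es ei eg _ p3 p4) => //; neq.
have F36 : ~~ sq e p3 p6 by apply: (@far3 _ _ es ei eg _ p4 p5) => //; neq.
have F47 : ~~ sq e p4 p7 by apply: (@far3 _ _ es ei eg _ p5 p6) => //; neq.
have F15 : ~~ sq e p1 p5 by apply: (@far4 _ _ es ei eg _ p2 p3 p4) => //; neq.
have F26 : ~~ sq e p2 p6 by apply: (@far4 _ _ es ei eg _ p3 p4 p5) => //; neq.
have F37 : ~~ sq e p3 p7 by apply: (@far4 _ _ es ei eg _ p4 p5 p6) => //; neq.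
have deg2 := d3 p2.
have deg4 := d3 p4.
have deg6 := d3 p6.
have h1 : 1 < #|avail L e S c p1| by count_avail [:: p2; p3] ([::] : seq T).
have h2 : 1 < #|avail L e S c p2| by count_avail [:: p1; p3; p4] [:: p1; p3].
have h3 : 3 < #|avail L e S c p3| by count_avail [:: p1; p2; p4; p5] ([::] : seq T).
have h4 : 2 < #|avail L e S c p4| by count_avail [:: p2; p3; p5; p6] [:: p3; p5].
have h5 : 3 < #|avail L e S c p5| by count_avail [:: p3; p4; p6; p7] ([::] : seq T).
have h6 : 1 < #|avail L e S c p6| by count_avail [:: p4; p5; p7] [:: p5; p7].
have h7 : 1 < #|avail L e S c p7| by count_avail [:: p5; p6] ([::] : seq T).
have extend k1 k2 k3 k4 k5 k6 k7 :
    square_path7_coloring (avail L e S c p1) (avail L e S c p2) (avail L e S c p3)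
      (avail L e S c p4) (avail L e S c p5) (avail L e S c p6) (avail L e S c p7)
      k1 k2 k3 k4 k5 k6 k7 ->
    sq e p1 p6 ==> (k1 != k6) -> sq e p2 p7 ==> (k2 != k7) ->
    exists c0, square_coloring L e c0.
  move=> [[? ? ? ?] [? ? ?] [? ? ? ?] [? ? ? ?] [? ? ?]] ? ?.
  apply: (@extend_square_coloring T e C L [:: (p1, k1); (p2, k2); (p3, k3); (p4, k4);
    (p5, k5); (p6, k6); (p7, k7)] c es cP).
  - rewrite /= andbT; split_goal.
    + few_outside [:: p2].
    + few_outside [:: p1; p3].
    + few_outside [:: p2].
    + few_outside [:: p3; p5].
    + few_outside [:: p4].
    + few_outside [:: p5; p7].
    + few_outside [:: p6].
  - by conj_by assumption.
  - by conj_by ltac:(first [assumption | apart]).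
have [q16|F16] := boolP (sq e p1 p6); have [q27|F27] := boolP (sq e p2 p7).
- by rewrite q16 q27 in F1627.
- have q61 : sq e p6 p1 by rewrite sq_sym.
  have h1' : 2 < #|avail L e S c p1| by count_avail [:: p2; p3; p6] ([::] : seq T).
  have h6' : 2 < #|avail L e S c p6| by count_avail [:: p1; p4; p5; p7] [:: p5; p7].
  have [k1 [k2 [k3 [k4 [k5 [k6 [k7 [K n16]]]]]]]] :=
    square_path7_chord16 h1' h2 h3 h4 h5 h6' h7.
  by apply: (extend _ _ _ _ _ _ _ K); [apply/implyP | rewrite (negPf F27)].
- have q72 : sq e p7 p2 by rewrite sq_sym.
  have h7' : 2 < #|avail L e S c p7| by count_avail [:: p2; p5; p6] ([::] : seq T).
  have h2' : 2 < #|avail L e S c p2| by count_avail [:: p1; p3; p4; p7] [:: p1; p3].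
  (* The same list lemma, with the path read backwards. *)
  have [k7 [k6 [k5 [k4 [k3 [k2 [k1 [K n72]]]]]]]] :=
    square_path7_chord16 h7' h6 h5 h4 h3 h2' h1.
  case: K => [[? ? ? ?] [? ? ?] [? ? ? ?] [? ? ? ?] [? ? ?]].
  apply: (extend k1 k2 k3 k4 k5 k6 k7); first by split; split; neq.
    by rewrite (negPf F16).
  by apply/implyP; rewrite eq_sym.
- have [k1 [k2 [k3 [k4 [k5 [k6 [k7 K]]]]]]] := square_path7 h1 h2 h3 h4 h5 h6 h7.
  by apply: (extend _ _ _ _ _ _ _ K); [rewrite (negPf F16) | rewrite (negPf F27)].
Qed.
End Reducible.

(** * Discharging *)

Section Discharging.
Variable T : finType.
Implicit Types (e : rel T).

(** The bound 18/7 on the maximum average degree, cleared of fractions and with degree sums in place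
    of twice the number of edges. *)
Definition sparse e := forall W : {set T}, W != set0 ->
  7 * \sum_(x in W) #|nbr e x :&: W| < 18 * #|W|.

Lemma nbr_isolate e S x : nbr (isolate S e) x \subset nbr e x.
Proof. by apply/subsetP => y; rewrite !inE => /and3P[]. Qed.

Lemma isolate_sym e S : symmetric e -> symmetric (isolate S e).
Proof. by move=> es x y; rewrite /isolate es andbA andbAC -andbA. Qed.

Lemma girth7_isolate e S : girth7 e -> girth7 (isolate S e).
Proof.
move=> eg c sz /andP[cc uc]; apply: eg => //; apply/andP; split=> //.
by apply: sub_cycle cc => x y /and3P[].
Qed.

Lemma sparse_isolate e S : sparse e -> sparse (isolate S e).
Proof.
move=> sp W /sp; apply: leq_ltn_trans; rewrite leq_mul2l /=.
by apply: leq_sum => x _; apply/subset_leq_card/setSI/nbr_isolate.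
Qed.

(** * Discharging in a graph without the reducible configurations *)

Section Irreducible.
Variable e : rel T.
Hypotheses (es : symmetric e) (ei : irreflexive e) (eg : girth7 e).
Hypothesis d3 : forall x, #|nbr e x| <= 3.
(** Only non-isolated vertices are concerned, because deleted vertices survive as isolated ones. *)
Hypothesis deg_gt1 : forall x y, e x y -> 1 < #|nbr e x|.
Hypothesis deg2_indep : forall x y, e x y -> #|nbr e x| <= 2 -> 2 < #|nbr e y|.
Hypothesis no_fork : forall v a b d x y,
  e v a -> e v b -> e v d -> e a x -> e x y ->
  #|nbr e a| <= 2 -> #|nbr e b| <= 2 -> #|nbr e d| <= 2 -> #|nbr e y| <= 2 ->
  a != b -> a != d -> b != d -> v != x -> a != y -> False.
Hypothesis no_cycle8 : forall v1 s1 v2 s2 v3 s3 v4 s4,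
  path e v1 [:: s1; v2; s2; v3; s3; v4; s4; v1] ->
  all (fun s => #|nbr e s| <= 2) [:: s1; s2; s3; s4] ->
  cycle (fun x y => x != y) [:: v1; v2; v3; v4] ->
  cycle (fun x y => x != y) [:: s1; s2; s3; s4] -> False.
Hypothesis no_path7 : forall p1 p2 p3 p4 p5 p6 p7,
  path e p1 [:: p2; p3; p4; p5; p6; p7] ->
  all (fun s => #|nbr e s| <= 2) [:: p1; p3; p5; p7] ->
  [&& p1 != p3, p2 != p4, p3 != p5, p4 != p6 & p5 != p7] ->
  ~~ sq e p1 p7 -> ~~ (sq e p1 p6 && sq e p2 p7) -> False.

Definition deg_set k := [set x | #|nbr e x| == k].

(** In the multigraph on the 3-vertices whose edges are the 2-vertices, [class v] is the degree of
    [v], and [heavy a] says that no end of the edge [a] is a leaf. *)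
Definition class v := #|nbr e v :&: deg_set 2|.

Definition heavy a := [forall v in nbr e a, 2 <= class v].

Lemma other_nbr a v : a \in deg_set 2 -> e a v ->
  exists2 x, v != x & nbr e a = [set v; x].
Proof.
rewrite inE => /cards2P[x [y [nxy E]]] av.
have : v \in [set x; y] by rewrite -E inE.
rewrite !inE => /orP[]/eqP ->; first by exists y.
by exists x; rewrite 1?eq_sym // setUC.
Qed.

Lemma heavy_second_deg2 a x : heavy a -> e a x ->
  exists2 y, e x y & (a != y) && (y \in deg_set 2).
Proof.
move=> /forall_inP H ax; have := H x; rewrite inE ax => /(_ isT).
rewrite /class => h; have [y] := @pick_notin_seq _ _ [:: a] h.
rewrite !inE => /andP[xy y2] nya; exists y => //.
by rewrite eq_sym nya inE.
Qed.

(** All neighbours of [v] are 2-vertices. If [a] were heavy, its other end would have a further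
    2-neighbour, completing a fork. *)
Lemma class3_not_heavy v a : class v = 3 -> e v a -> ~~ heavy a.
Proof.
move=> c3 va; apply/negP => Ha.
have N2 y : e v y -> y \in deg_set 2.
  move=> vy; suff /setIidPl/subsetP /(_ y) : nbr e v :&: deg_set 2 = nbr e v.
    by apply; rewrite inE.
  by apply/eqP; rewrite eqEcard subsetIl -/(class v) c3 d3.
have le2 y : e v y -> #|nbr e y| <= 2 by move/N2; rewrite inE => /eqP ->.
have : #|nbr e v :\ a| == 2.
  have : class v <= #|nbr e v| by apply/subset_leq_card/subsetIl.
  rewrite c3 (cardsD1 a) inE va; have := d3 v; rewrite (cardsD1 a) inE va.
  by case: #|_| => [|[|[|]]].
case/cards2P => b [d [nbd E]].
have /setD1P[nba vb] : b \in nbr e v :\ a by rewrite E !inE eqxx.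
have /setD1P[nda vd] : d \in nbr e v :\ a by rewrite E !inE eqxx orbT.
rewrite inE in vb; rewrite inE in vd.
have av : e a v by rewrite es.
have [x nvx Ea] := other_nbr (N2 _ va) av.
have ax : x \in nbr e a by rewrite Ea !inE eqxx orbT.
rewrite inE in ax; have [y xy /andP[nay]] := heavy_second_deg2 Ha ax.
rewrite inE => /eqP y2.
apply: (no_fork va vb vd ax xy (le2 _ va) (le2 _ vb) (le2 _ vd)) => //.
- by rewrite y2.
- by rewrite eq_sym.
- by rewrite eq_sym.
Qed.

(** Two heavy edges at [v] extend to a path [y], [x], [a], [v], [b], [z], [w] alternating between
    2-vertices and others. Let [t] and [u] be the remaining neighbours of [y] and [w]: if they
    coincide there is a forbidden 8-cycle, otherwise a forbidden path. *)
Lemma heavy_nbr_unique v a b : e v a -> e v b ->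
  a \in deg_set 2 -> b \in deg_set 2 -> heavy a -> heavy b -> a = b.
Proof.
move=> va vb a2 b2 Ha Hb; apply/eqP; apply/negPn/negP => nab.
have av : e a v by rewrite es.
have bv : e b v by rewrite es.
have [x nvx Ea] := other_nbr a2 av; have [z nvz Eb] := other_nbr b2 bv.
have : x \in nbr e a by rewrite Ea !inE eqxx orbT.
rewrite inE => ax.
have : z \in nbr e b by rewrite Eb !inE eqxx orbT.
rewrite inE => bz.
have [y xy /andP[nay y2]] := heavy_second_deg2 Ha ax.
have [w zw /andP[nbw w2]] := heavy_second_deg2 Hb bz.
have yx : e y x by rewrite es.
have wz : e w z by rewrite es.
have xa : e x a by rewrite es.
have zb : e z b by rewrite es.
have [t nxt Ey] := other_nbr y2 yx; have [u nzu Ew] := other_nbr w2 wz.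
have : t \in nbr e y by rewrite Ey !inE eqxx orbT.
rewrite inE => yt.
have : u \in nbr e w by rewrite Ew !inE eqxx orbT.
rewrite inE => wu.
have ty : e t y by rewrite es.
have uw : e u w by rewrite es.
have nxv : x != v by rewrite eq_sym.
have nya : y != a by rewrite eq_sym.
have nzv : z != v by rewrite eq_sym.
have nwb : w != b by rewrite eq_sym.
have nba : b != a by rewrite eq_sym.
have nuz : u != z by rewrite eq_sym.
have ntx : t != x by rewrite eq_sym.
have le2 s : s \in deg_set 2 -> #|nbr e s| <= 2 by rewrite inE => /eqP ->.
have : uniq [:: y; x; a; v; b; z; w].
  apply: (walk_uniq ei eg) => //=; first by rewrite yx xa av vb bz zw.
  by rewrite nya nxv nab nvz nbw.
rewrite /= !inE !negb_or -!andbA !andbT.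
case/and5P=> _ _ _ _ /and5P[_ nyw _ _ /and5P[nxb nxz nxw _ _]].
have xwF : ~~ e x w.
  apply/negP => xw; apply: (no_closed_walk ei eg (x := x) (s := [:: a; v; b; z; w; x])) => //=.
    by rewrite xa av vb bz zw es xw.
  by rewrite nxv nab nvz nbw eq_sym nxz.
have zyF : ~~ e z y.
  apply/negP => zy; apply: (no_closed_walk ei eg (x := z) (s := [:: b; v; a; x; y; z])) => //=.
    by rewrite zb bv va ax xy es zy.
  by rewrite nzv nba nvx nay nxz.
have xzF : ~~ e x z.
  apply/negP => xz; apply: (no_closed_walk ei eg (x := x) (s := [:: a; v; b; z; x])) => //=.
    by rewrite xa av vb bz es xz.
  by rewrite nxv nab nvz eq_sym nxb.
have [tu|ntu] := eqVneq t u.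
  apply: (@no_cycle8 v b z w t y x a) => /=.
  - by rewrite vb bz zw ty yx xa av tu wu.
  - by rewrite !le2.
  - by rewrite nvz ntx nxv tu nzu.
  - by rewrite nbw nya nab eq_sym nyw.
have y_nbr q : e y q -> q = x \/ q = t.
  have -> : e y q = (q \in nbr e y) by rewrite inE.
  by rewrite Ey !inE => /orP[]/eqP; [left | right].
have w_nbr q : e w q -> q = z \/ q = u.
  have -> : e w q = (q \in nbr e w) by rewrite inE.
  by rewrite Ew !inE => /orP[]/eqP; [left | right].
apply: (@no_path7 y x a v b z w) => /=.
- by rewrite yx xa av vb bz zw.
- by rewrite !le2.
- by rewrite nya nxv nab nvz nbw.
(* A common neighbour of [y] and [w] is [x] or [t], and also [z] or [u]; each combination has been
   excluded. *)
- apply/negP => /andP[_ /orP[yw|/existsP[q /andP[yq qw]]]].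
    by have := deg2_indep yw (le2 _ y2); rewrite ltnNge le2.
  have wq : e w q by rewrite es.
  case: (y_nbr q yq) => E; first by rewrite E in qw; rewrite qw in xwF.
  case: (w_nbr q wq) => E'; first by move: zyF; rewrite -E' es yq.
  by move: ntu; rewrite -E E' eqxx.
(* If both pairs five steps apart were adjacent in the square, the connections would have to pass
   through [t] and [u], giving the closed walk [t], [z], [w], [u], [x], [y] of length six. *)
apply/andP => -[/andP[_ yz] /andP[_ xw]].
have tz : e t z.
  case/orP: yz => [|/existsP[q /andP[/y_nbr[]-> //]]].
    by rewrite es (negPf zyF).
  by rewrite (negPf xzF).
have ux : e u x.
  case/orP: xw => [|/existsP[q /andP[xq qw]]]; first by rewrite (negPf xwF).
  have wq : e w q by rewrite es.
  case: (w_nbr q wq) => E; first by move: xzF; rewrite -E xq.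
  by rewrite es -E.
have t3 := deg2_indep yt (le2 _ y2).
have u3 := deg2_indep wu (le2 _ w2).
have ntw : t != w by apply: contraTneq t3 => ->; rewrite -leqNgt le2.
have nuy : u != y by apply: contraTneq u3 => ->; rewrite -leqNgt le2.
apply: (no_closed_walk ei eg (x := t) (s := [:: z; w; u; x; y; t])) => //=.
  by rewrite tz zw wu ux xy yt.
by rewrite ntw nzu eq_sym nxw nuy nxt.
Qed.

(* The charge sent by the 3-vertex [v] to its 2-neighbour [a].  Scaled so that an
   edge of the multigraph needs 4 and a vertex owns 3: the ratio 3/4 above. *)
Definition charge v a := if class v <= 1 then 3 else 1 + heavy a.

(** A heavy [a] gets 2 from each end. Otherwise some end has class at most 1 and gives 3, and the
    other gives at least 1. *)
Lemma charge_received a : a \in deg_set 2 -> 4 <= \sum_(v in nbr e a) charge v a.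
Proof.
rewrite inE => /cards2P[u [v [nuv E]]]; rewrite E big_setU1 ?inE // big_set1 /=.
rewrite /charge; have [Ha|] := boolP (heavy a).
  have Hc x : x \in [set u; v] -> (class x <= 1) = false.
    by rewrite -E leqNgt => /(forall_inP Ha) ->.
  by rewrite !Hc // !inE eqxx ?orbT.
rewrite /heavy negb_forall_in => /exists_inP[x].
rewrite E -leqNgt !inE => /orP[]/eqP -> ->; first by case: ifP.
by rewrite addnC; case: ifP.
Qed.

(** Class at most 1 sends at most one charge of 3. Class 2 sends 1 twice, plus 1 for at most one
    heavy neighbour. Class 3 sends 1 three times, as it has no heavy neighbour. *)
Lemma charge_sent v : \sum_(a in nbr e v :&: deg_set 2) charge v a <= 3.
Proof.
rewrite /charge; have [c1|c2] := leqP (class v) 1.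
  by rewrite sum_nat_const -/(class v); move: c1; case: (class v) => [|[]].
rewrite big_split /= sum1_card -/(class v).
have c3 : class v <= 3 by apply: leq_trans (d3 v); apply/subset_leq_card/subsetIl.
have -> : \sum_(a in nbr e v :&: deg_set 2) nat_of_bool (heavy a) =
          #|[set a in nbr e v :&: deg_set 2 | heavy a]|.
  by rewrite -sum1dep_card big_mkcondr.
have [c3'|c3'] := eqVneq (class v) 3.
  rewrite c3' (_ : [set a in _ | _] = set0) ?cards0 //.
  apply/setP => a; rewrite !inE; apply/negP => /andP[/andP[va _]].
  by apply/negP; apply: class3_not_heavy va.
have h1 : #|[set a in nbr e v :&: deg_set 2 | heavy a]| <= 1.
  apply/card_le1_eqP => a b.
  rewrite !inE => /andP[/andP[va a2] Ha] /andP[/andP[vb b2] Hb].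
  by apply: (heavy_nbr_unique vb va) => //; rewrite inE.
have : class v = 2 by lia.
by move=> ->; move: h1; case: #|_| => [|[]].
Qed.

Lemma not_sparse x y : e x y -> ~ sparse e.
Proof.
move=> xy sp; pose W := deg_set 2 :|: deg_set 3.
have WE u w : e u w -> u \in W.
  move=> uw; rewrite !inE; have := d3 u; have := deg_gt1 uw.
  by case: #|_| => [|[|[|[|]]]].
have W0 : W != set0 by apply/set0Pn; exists x; apply: WE xy.
have disj : [disjoint deg_set 2 & deg_set 3].
  by rewrite -setI_eq0; apply/eqP/setP => u; rewrite !inE; case: eqP => // ->.
have := sp _ W0; rewrite cardsU (disjoint_setI0 disj) cards0 subn0.
have -> : \sum_(u in W) #|nbr e u :&: W| = 2 * #|deg_set 2| + 3 * #|deg_set 3|.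
  rewrite (big_setID (deg_set 2)) /= {1 3}/W setUK setDUl setDv set0U.
  rewrite (setDidPl _) 1?disjoint_sym // mulnC [3 * _]mulnC -!sum_nat_const.
  have nW u : nbr e u :&: W = nbr e u.
    by apply/setIidPl/subsetP => w; rewrite inE es => /WE.
  by congr (_ + _); apply: eq_bigr => u; rewrite inE nW => /eqP.
(* With n2 and n3 vertices of degrees 2 and 3, this is equivalent to 7 (2 n2 + 3 n3) >= 18 (n2 +
   n3), which contradicts sparsity on [W]. *)
suff : 4 * #|deg_set 2| <= 3 * #|deg_set 3| by lia.
rewrite mulnC -sum_nat_const.
apply: (@leq_trans (\sum_(a in deg_set 2) \sum_(v in nbr e a) charge v a)).
  by apply: leq_sum => a /charge_received.
(* Swapping the sums relies on 2-vertices having only 3-vertices as neighbours. *)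
rewrite (exchange_big_dep (fun v => v \in deg_set 3)) /=.
  rewrite mulnC -sum_nat_const; apply: leq_sum => v _.
  apply: leq_trans (charge_sent v); rewrite leq_eqVlt; apply/orP; left; apply/eqP.
  by apply: eq_bigl => a; rewrite !inE es andbC.
move=> a v a2; rewrite !inE => av.
have := @deg2_indep a v av; rewrite inE in a2; rewrite (eqP a2) => /(_ isT).
by have := d3 v; case: #|_| => [|[|[|[|]]]].
Qed.
End Irreducible.

Theorem sparse_square_colorable e (C : finType) (L : T -> {set C}) :
  symmetric e -> irreflexive e -> girth7 e -> (forall x, #|nbr e x| <= 3) ->
  sparse e -> (forall x, 6 <= #|L x|) -> exists c, square_coloring L e c.
Proof.
move=> es ei eg d3 sp L6.
have [n] := ubnP #|[set x | 0 < #|nbr e x|]|.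
elim: n e es ei eg d3 sp => // n IH e es ei eg d3 sp lt_n.
apply: contrapT => NC.
(* Isolating a set that contains the end [x] of an edge leaves fewer non-isolated vertices, so the
   induction hypothesis supplies the colouring that [reducible] starts from. *)
have irred S x y : x \in S -> e x y -> ~ reducible e L S.
  move=> xS xy red; apply/NC/red; apply: IH.
  - exact: isolate_sym.
  - by move=> u; rewrite /isolate ei.
  - exact: girth7_isolate.
  - by move=> u; apply: leq_trans (d3 u); apply/subset_leq_card/nbr_isolate.
  - exact: sparse_isolate.
  - rewrite -ltnS; apply: leq_trans lt_n; rewrite ltnS; apply: proper_card.
    apply/properP; split.
      apply/subsetP => u; rewrite !inE => h; apply: leq_trans h _.
      exact/subset_leq_card/nbr_isolate.
    exists x; rewrite !inE; first by apply/card_gt0P; exists y; rewrite inE.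
    by rewrite -leqNgt leqn0 cards_eq0; apply/eqP/setP => u;
      rewrite !inE /isolate xS andbF.
have [[x [y xy]]|noedge] := pselect (exists x y, e x y); last first.
  have L0 x : exists k, k \in L x.
    by apply/card_gt0P; apply: leq_trans (L6 x).
  apply: NC; exists (fun x => xchoose (L0 x)); split=> [x|x y]; first exact: xchooseP.
  case/andP=> _ /orP[xy|/existsP[z /andP[xz _]]].
    by case: noedge; exists x, y.
  by case: noedge; exists x, z.
apply: (@not_sparse e es ei eg d3 _ _ _ _ _ x y xy sp).
- move=> u w uw; rewrite ltnNge; apply/negP => u1.
  by apply: (irred [:: u] u w); rewrite ?inE //; apply: reducible_degree1.
- move=> u w uw u2; rewrite ltnNge; apply/negP => w2.
  apply: (irred [:: u; w] u w) => //; first by rewrite inE eqxx.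
  exact: reducible_adjacent_degree2.
- move=> v a b d u w va *.
  apply: (irred [:: v; a; b; d; u; w] v a) => //; first by rewrite inE eqxx.
  exact: reducible_fork.
- move=> v1 s1 v2 s2 v3 s3 v4 s4 p *.
  apply: (irred [:: v1; s1; v2; s2; v3; s3; v4; s4] v1 s1).
  + by rewrite inE eqxx.
  + by case/andP: p.
  + exact: reducible_cycle8.
- move=> p1 p2 p3 p4 p5 p6 p7 p *.
  apply: (irred [:: p1; p2; p3; p4; p5; p6; p7] p1 p2).
  + by rewrite inE eqxx.
  + by case/andP: p.
  + exact: reducible_path7.
Qed.
End Discharging.

(** * Maximum average degree *)

(** Ordered adjacent pairs are grouped by the edge they span, at most two to an edge. *)
Lemma sum_degree_le (G : sgraph) : \sum_(x : G) degree x <= 2 * #|edges G|.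
Proof.
have -> : \sum_(x : G) degree x = \sum_(p : G * G | adj p.1 p.2) 1.
  rewrite -(pair_big_dep predT (@adj G) (fun _ _ => 1)) /=.
  by apply: eq_bigr => x _; rewrite sum1dep_card.
rewrite (partition_big (fun p : G * G => [set p.1; p.2]) (mem (edges G))) /=; last first.
  move=> [x y] /= xy; rewrite inE; apply/existsP; exists x.
  by apply/existsP; exists y; rewrite xy eqxx.
rewrite mulnC -sum_nat_const; apply: leq_sum => A.
rewrite inE => /existsP[x /existsP[y /andP[xy /eqP ->]]].
rewrite sum1dep_card; apply: leq_trans (_ : #|[set (x, y); (y, x)]| <= 2); last first.
  by rewrite cards2; case: (_ == _).
apply/subset_leq_card/subsetP => -[u v]; rewrite !inE /= => /andP[uv /eqP/setP E].
have := E u; have := E v; rewrite !inE !eqxx orbT => /esym Hv /esym Hu.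
rewrite -!pair_eqE /pair_eq /=.
have nuv : u != v by apply: contraTneq uv => ->; rewrite adj_irr.
by case/orP: Hu Hv nuv => /eqP -> /orP[]/eqP ->; rewrite ?eqxx ?orbT.
Qed.

Lemma sum_degree_induced (G : sgraph) (W : {set G}) :
  \sum_(u : induced W) degree u = \sum_(x in W) #|nbr (@adj G) x :&: W|.
Proof.
rewrite [RHS]big_sub; apply: eq_bigr => u _; rewrite /degree.
rewrite -(card_imset _ val_inj); apply: eq_card => y.
apply/imsetP/idP => [[w]|].
  by rewrite !inE => uw ->; apply/andP; split; [exact: uw | exact: valP].
rewrite !inE => /andP[uy yW]; exists (exist _ y yW) => //.
by rewrite inE.
Qed.

Lemma sparse_of_mad (G : sgraph) :
  (mad G < 18%:R / 7%:R)%R -> sparse (@adj G).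
Proof.
move=> hmad W W0; rewrite -sum_degree_induced.
have : (average_degree (induced W) < 18%:R / 7%:R)%R.
  by apply: le_lt_trans hmad; rewrite /mad; apply: (@le_bigmax_cond _ _ _ _ W).
have -> : #|W| = #|induced W| by rewrite /= card_sig.
have n0 : 0 < #|induced W| by rewrite /= card_sig card_gt0.
rewrite /average_degree ltr_pdivrMr ?ltr0n // mulrAC ltr_pdivlMr ?ltr0n //.
rewrite -!natrM ltr_nat; have := sum_degree_le (induced W); lia.
Qed.

Theorem theorem20 (G : sgraph)
  (hdeg : max_degree G <= 3)
  (hgirth : girth_ge G 7)
  (hmad : (mad G < 18%:R / 7%:R)%R) :
  list_chromatic_number (square G) <= 6.
Proof.
suff ch : choosable (square G) 6.
  by rewrite /list_chromatic_number; case: ex_minnP => m _ /(_ 6); apply; apply/asboolP.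
move=> C L L6.
have [||c [cL cP]] := @sparse_square_colorable G (@adj G) C L (@adj_sym G) (@adj_irr G)
  _ _ (sparse_of_mad hmad) L6.
- by move=> c sz cyc; apply: hgirth.
- by move=> x; apply: leq_trans hdeg; apply: (leq_bigmax_cond (F := @degree G)).
exists c; split=> // x y /andP[nxy /existsP[n /existsP[p h]]].
apply/eqP/cP; rewrite /sq nxy /=.
have: size p < 3 by rewrite size_tuple.
move: h.
(* A walk of length 0 contradicts [x != y], length 1 is an edge, and length 2 gives a common
   neighbour. *)
case: (tval p) => [|a [|b [|]]] //= h _.
- by rewrite h in nxy.
- by move: h; rewrite andbT => /andP[xa /eqP <-]; rewrite xa.
- move: h; rewrite andbT => /andP[/andP[xa ab] /eqP <-]; apply/orP; right.
  by apply/existsP; exists a; rewrite xa.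
Qed.
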